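(* Let $\mathcal{R}$ be an LCTRS and suppose $\Pi X.\,s\,[\exists\vec{x}.\varphi]\to^*_{\mathcal R}\Pi Y.\,t\,[\exists\vec{y}.\psi]$. Then (1) for each $u\in[\![\Pi X.\,s\,[\exists\vec{x}.\varphi]]\!]$ there exists $v\in[\![\Pi Y.\,t\,[\exists\vec{y}.\psi]]\!]$ such that $u\to^*_{[\![\mathcal R]\!]}v$; and (2) for each $v\in[\![\Pi Y.\,t\,[\exists\vec{y}.\psi]]\!]$ there exists $u\in[\![\Pi X.\,s\,[\exists\vec{x}.\varphi]]\!]$ such that $u\to^*_{[\![\mathcal R]\!]}v$.
   Context: Terms are built over a sorted signature whose function symbols are split into theory symbols (whose argument and result sorts are theory sorts) and term symbols, and a set $\mathcal{V}$ of sorted variables; theory sorts and symbols are interpreted in a fixed model $\mathcal{M}$. Every element of the interpretation of each theory sort is a constant symbol, called a value; $\mathcal{V}al$ denotes the set of values. There is a theory sort of Booleans with standard interpretation and the usual connectives. A constraint is a Boolean-sorted term built from theory symbols and variables; a (possibly existentially quantified) formula is valid if it is true under all valuations of its free variables in $\mathcal{M}$ and satisfiable if true under some. $\mathcal{V}ar(\cdot)$ is the set of variables. A substitution $\sigma$ is a sort-preserving map from variables to terms with finite domain $\mathcal{D}om(\sigma)=\{x\mid \sigma(x)\neq x\}$; $\mathcal{V}Dom(\sigma)=\{x\mid\sigma(x)\in\mathcal{V}al\}$; $\sigma$ is $X$-valued if $\sigma(X)\subseteq\mathcal{V}al$. An existential constraint $\exists\vec{x}.\varphi$ is a sequence of variables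 $\vec x$ together with a constraint $\varphi$ with $\{\vec x\}\subseteq\mathcal{V}ar(\varphi)$; its free variables are $\mathcal{FV}ar(\exists\vec x.\varphi)=\mathcal{V}ar(\varphi)\setminus\{\vec x\}$. For a substitution $\sigma$, $\sigma\vDash_{\mathcal M}\exists\vec x.\varphi$ means $\sigma$ is $\mathcal{FV}ar(\exists\vec x.\varphi)$-valued and $(\exists\vec x.\varphi)\sigma$ is valid. An existentially constrained term $\Pi X.\,s\,[\exists\vec x.\varphi]$ consists of a set $X$ of variables, a term $s$ and an existential constraint with $\mathcal{FV}ar(\exists\vec x.\varphi)\subseteq X\subseteq\mathcal{V}ar(s)$ and $\{\vec x\}\cap\mathcal{V}ar(s)=\emptyset$; it is satisfiable if $\exists\vec x.\varphi$ is satisfiable. A constrained rewrite rule $\rho\colon \Pi Z.\,\ell\to r\,[\pi]$ consists of a set $Z$ of variables, terms $\ell,r$ of the same sort and a constraint $\pi$ with $\mathcal{V}ar(\pi)\cup(\mathcal{V}ar(r)\setminus\mathcal{V}ar(\ell))\subseteq Z$; it is left-linear if $\ell$ is linear; $\mathcal{E}x\mathcal{V}ar(\rho)=\mathcal{V}ar(r)\setminus\mathcal{V}ar(\ell)$. Let $\Pi X.\,s\,[\exists\vec x.\varphi]$ be satisfiable, $\rho$ left-linear with $\mathcal{V}ar(\rho)\cap\mathcal{V}ar(s,\varphi)=\emptyset$, and $\{\vec z\}=\mathcal{V}ar(\pi)\setminus\mathcal{V}ar(\ell)$. The term has a $\rho$-redex at position $p$ of $s$ using $\gamma$ if (i) $\mathcal{D}om(\gamma)=\mathcal{V}ar(\ell)$,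 (ii) $s|_p=\ell\gamma$, (iii) $\gamma(x)\in\mathcal{V}al\cup X$ for all $x\in\mathcal{V}ar(\ell)\cap Z$, and (iv) $(\exists\vec x.\varphi)\Rightarrow(\exists\vec z.\pi\gamma)$ is valid; then, with $t=s[r\gamma]_p$, $\psi=\varphi\wedge\pi\gamma$, $\{\vec y\}=\mathcal{V}ar(\psi)\setminus\mathcal{V}ar(t)$, $Y=\mathcal{E}x\mathcal{V}ar(\rho)\cup(X\cap\mathcal{V}ar(t))$, there is a most general rewrite step $\Pi X.\,s\,[\exists\vec x.\varphi]\to^p_{\rho,\gamma}\Pi Y.\,t\,[\exists\vec y.\psi]$. One writes $\to_\rho$ if such a step exists for some position, some $\gamma$ and some renamed variant of $\rho$ whose variables are disjoint from those of the source term. An LCTRS $\mathcal R$ is a set of left-linear constrained rewrite rules (including the calculation rules for theory symbols); $\to_{\mathcal R}=\bigcup_{\rho\in\mathcal R}\to_\rho$ and $\to^*_{\mathcal R}$ is its reflexive–transitive closure. For a set $R$ of pairs of ordinary terms, $u\to^p_R v$ means there are $\langle l,r'\rangle\in R$ and a substitution $\theta$ with $u|_p=l\theta$ and $v=u[r'\theta]_p$; $\to_R$ is the union over all positions and $\to^*_R$ its reflexive–transitive closure. Interpretation of a constrained term: $[\![\Pi X.\,s\,[\exists\vec x.\varphi]]\!]=\{s\sigma\mid\sigma(X)\subseteq\mathcal{V}al,\ \sigma\vDash_{\mathcal M}\exists\vec x.\varphi\}$. Interpretation of a rule $\rho\colon\Pi Z.\,\ell\to r\,[\pi]$: $[\![\rho]\!]=\{\langle\ell\sigma,r\sigma\rangle\mid\mathcal{D}om(\sigma)=\mathcal{V}Dom(\sigma)=Z\cap\mathcal{V}ar(\ell,r),\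 \sigma\vDash_{\mathcal M}\exists\vec z'.\pi\}$ where $\{\vec z'\}=\mathcal{V}ar(\pi)\setminus\mathcal{V}ar(\ell,r)$; $[\![\mathcal R]\!]=\bigcup_{\rho\in\mathcal R}[\![\rho]\!]$.
   Formalization: The sets X of constrained terms and Z of rules are required to consist of theory-sorted variables (otherwise part (2) fails, e.g. for f(x) → a with a non-theory variable x in X), and theory sorts are interpreted by nonempty sets. *)

(* Defs.v *)
From mathcomp Require Import all_boot.
From mathcomp Require Import boolp classical_sets cardinality.
From Stdlib Require List.
From Stdlib Require Import Relation_Operators.

Set Implicit Arguments.
Unset Strict Implicit.
Unset Printing Implicit Defensive.

Local Open Scope classical_set_scope.

(* [value_sort a = tau] says that [a] is an element of the interpretation of
   the theory sort [tau]; these elements are themselves constant symbols, so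
   [value] is part of the signature.  The full set of theory symbols consists
   of [value] and [theory_sym]: the latter are the theory symbols that are not
   values. *)
Record signature := Signature {
  theory_sort : Type;
  term_sort : Type;
  bool_sort : theory_sort;
  var : eqType;
  var_sort : var -> theory_sort + term_sort;
  value : Type;
  value_sort : value -> theory_sort;
  theory_sym : Type;
  theory_dom : theory_sym -> seq theory_sort;
  theory_cod : theory_sym -> theory_sort;
  term_sym : Type;
  term_dom : term_sym -> seq (theory_sort + term_sort);
  term_cod : term_sym -> theory_sort + term_sort;
  not_sym : theory_sym;
  and_sym : theory_sym;
  or_sym : theory_sym;
  imp_sym : theory_sym;
  iff_sym : theory_sym;
  not_dom : theory_dom not_sym = [:: bool_sort];
  not_cod : theory_cod not_sym = bool_sort;
  and_dom : theory_dom and_sym = [:: bool_sort; bool_sort];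
  and_cod : theory_cod and_sym = bool_sort;
  or_dom : theory_dom or_sym = [:: bool_sort; bool_sort];
  or_cod : theory_cod or_sym = bool_sort;
  imp_dom : theory_dom imp_sym = [:: bool_sort; bool_sort];
  imp_cod : theory_cod imp_sym = bool_sort;
  iff_dom : theory_dom iff_sym = [:: bool_sort; bool_sort];
  iff_cod : theory_cod iff_sym = bool_sort
}.

Definition sort (Sg : signature) : Type := (theory_sort Sg + term_sort Sg)%type.

(* The values of [interp f] on argument lists that do not match the arity of
   [f] are irrelevant. *)
Record model (Sg : signature) := Model {
  interp : theory_sym Sg -> seq (value Sg) -> value Sg;
  interp_sort : forall (f : theory_sym Sg) (vs : seq (value Sg)),
    map (@value_sort Sg) vs = theory_dom f ->
    value_sort (interp f vs) = theory_cod f;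
  carrier_nonempty : forall tau : theory_sort Sg,
    exists a : value Sg, value_sort a = tau;
  vbool : bool -> value Sg;
  vbool_inj : injective vbool;
  vbool_onto : forall a : value Sg,
    value_sort a = bool_sort Sg <-> exists b : bool, a = vbool b;
  interp_not : forall a : bool,
    interp (not_sym Sg) [:: vbool a] = vbool (~~ a);
  interp_and : forall a b : bool,
    interp (and_sym Sg) [:: vbool a; vbool b] = vbool (a && b);
  interp_or : forall a b : bool,
    interp (or_sym Sg) [:: vbool a; vbool b] = vbool (a || b);
  interp_imp : forall a b : bool,
    interp (imp_sym Sg) [:: vbool a; vbool b] = vbool (a ==> b);
  interp_iff : forall a b : bool,
    interp (iff_sym Sg) [:: vbool a; vbool b] = vbool (a == b)
}.

Inductive symbol (Sg : signature) : Type :=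
| ValSym of value Sg
| ThSym of theory_sym Sg
| TeSym of term_sym Sg.

Definition sym_dom (Sg : signature) (f : symbol Sg) : seq (sort Sg) :=
  match f with
  | ValSym _ => [::]
  | ThSym g => [seq inl tau | tau <- theory_dom g]
  | TeSym g => term_dom g
  end.

Definition sym_cod (Sg : signature) (f : symbol Sg) : sort Sg :=
  match f with
  | ValSym a => inl (value_sort a)
  | ThSym g => inl (theory_cod g)
  | TeSym g => term_cod g
  end.

Inductive term (Sg : signature) : Type :=
| Var of var Sg
| Fun of symbol Sg & seq (term Sg).

Inductive has_sort (Sg : signature) : term Sg -> sort Sg -> Prop :=
| has_sort_var (x : var Sg) : has_sort (Var x) (var_sort x)
| has_sort_fun (f : symbol Sg) (ts : seq (term Sg)) :
    List.Forall2 (@has_sort Sg) ts (sym_dom f) ->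
    has_sort (Fun f ts) (sym_cod f).

Fixpoint vars (Sg : signature) (t : term Sg) : seq (var Sg) :=
  match t with
  | Var x => [:: x]
  | Fun _ ts => flatten [seq vars u | u <- ts]
  end.

Definition Vars (Sg : signature) (t : term Sg) : set (var Sg) :=
  [set x | x \in vars t].

Definition linear (Sg : signature) (t : term Sg) : Prop := uniq (vars t).

Definition theory_vars (Sg : signature) : set (var Sg) :=
  [set x | exists tau : theory_sort Sg, var_sort x = inl tau].

Definition Val (Sg : signature) : set (term Sg) :=
  [set t | exists a : value Sg, t = Fun (ValSym a) [::]].
Arguments Val {Sg}.

Definition Dom (Sg : signature) (s : var Sg -> term Sg) : set (var Sg) :=
  [set x | s x <> Var x].

Definition VDom (Sg : signature) (s : var Sg -> term Sg) : set (var Sg) :=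
  [set x | Val (s x)].

Record substitution (Sg : signature) := Substitution {
  subst_fun :> var Sg -> term Sg;
  subst_sorted : forall x : var Sg, has_sort (subst_fun x) (var_sort x);
  subst_finite : finite_set (Dom subst_fun)
}.

Fixpoint subst (Sg : signature) (s : var Sg -> term Sg) (t : term Sg) :
    term Sg :=
  match t with
  | Var x => s x
  | Fun f ts => Fun f [seq subst s u | u <- ts]
  end.

Definition valued (Sg : signature) (X : set (var Sg))
    (s : var Sg -> term Sg) : Prop := s @` X `<=` Val.

(* Positions are sequences of argument indices, counted from 0. *)
Fixpoint subterm_at (Sg : signature) (t : term Sg) (p : seq nat) :
    option (term Sg) :=
  match p with
  | [::] => Some t
  | i :: q =>
      match t with
      | Var _ => None
      | Fun _ ts => if onth ts i is Some u then subterm_at u q else None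
      end
  end.

(* [replace_at t p u] is t[u]_p; it is only used when [p] is a position of
   [t]. *)
Fixpoint replace_at (Sg : signature) (t : term Sg) (p : seq nat)
    (u : term Sg) : term Sg :=
  match p with
  | [::] => u
  | i :: q =>
      match t with
      | Var _ => t
      | Fun f ts =>
          if onth ts i is Some w
          then Fun f (take i ts ++ replace_at w q u :: drop i.+1 ts)
          else t
      end
  end.

Fixpoint theory_term (Sg : signature) (t : term Sg) : bool :=
  match t with
  | Var _ => true
  | Fun (TeSym _) _ => false
  | Fun _ ts => all (@theory_term Sg) ts
  end.

Definition is_constraint (Sg : signature) (phi : term Sg) : Prop :=
  has_sort phi (inl (bool_sort Sg)) /\ theory_term phi.

Definition andt (Sg : signature) (phi psi : term Sg) : term Sg :=
  Fun (ThSym (and_sym Sg)) [:: phi; psi].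

(* The value of a valuation at a variable of a non-theory sort is irrelevant. *)
Record valuation (Sg : signature) := Valuation {
  val_fun :> var Sg -> value Sg;
  val_sorted : forall (x : var Sg) (tau : theory_sort Sg),
    var_sort x = inl tau -> value_sort (val_fun x) = tau
}.

(* The clause for term symbols is a dummy: they do not occur in constraints. *)
Fixpoint eval (Sg : signature) (M : model Sg) (nu : var Sg -> value Sg)
    (t : term Sg) : value Sg :=
  match t with
  | Var x => nu x
  | Fun (ValSym a) _ => a
  | Fun (ThSym f) ts => interp M f [seq eval M nu u | u <- ts]
  | Fun (TeSym _) _ => vbool M false
  end.

Record exformula (Sg : signature) := Ex {
  bvars : seq (var Sg);
  body : term Sg
}.

Definition BVar (Sg : signature) (e : exformula Sg) : set (var Sg) :=
  [set x | x \in bvars e].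

Definition FVar (Sg : signature) (e : exformula Sg) : set (var Sg) :=
  Vars (body e) `\` BVar e.

Definition is_exconstraint (Sg : signature) (e : exformula Sg) : Prop :=
  is_constraint (body e) /\ BVar e `<=` Vars (body e).

(* A substitution acts on the free variables only; no renaming of bound
   variables is performed, as this is only used for substitutions that map
   the free variables to values. *)
Definition exsubst (Sg : signature) (s : var Sg -> term Sg)
    (e : exformula Sg) : exformula Sg :=
  Ex (bvars e) (subst (fun x => if x \in bvars e then Var x else s x) (body e)).

Definition holds (Sg : signature) (M : model Sg) (nu : valuation Sg)
    (e : exformula Sg) : Prop :=
  exists nu' : valuation Sg,
    (forall x, x \notin bvars e -> nu' x = nu x) /\
    eval M nu' (body e) = vbool M true.

Definition valid (Sg : signature) (M : model Sg) (e : exformula Sg) : Prop :=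
  forall nu : valuation Sg, holds M nu e.

Definition valid_imp (Sg : signature) (M : model Sg)
    (e1 e2 : exformula Sg) : Prop :=
  forall nu : valuation Sg, holds M nu e1 -> holds M nu e2.

Definition satisfiable (Sg : signature) (M : model Sg)
    (e : exformula Sg) : Prop :=
  exists nu : valuation Sg, holds M nu e.

Definition models (Sg : signature) (M : model Sg) (s : substitution Sg)
    (e : exformula Sg) : Prop :=
  valued (FVar e) s /\ valid M (exsubst s e).

(* The Pi-bound variables of a constrained term or of a rule stand for values
   and therefore have theory sorts. *)
Record cterm (Sg : signature) := CTerm {
  ct_set : set (var Sg);
  ct_term : term Sg;
  ct_con : exformula Sg;
  ct_set_theory : ct_set `<=` @theory_vars Sg;
  ct_term_sorted : exists a : sort Sg, has_sort ct_term a;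
  ct_con_wf : is_exconstraint ct_con;
  ct_fvar : FVar ct_con `<=` ct_set;
  ct_set_vars : ct_set `<=` Vars ct_term;
  ct_bvar : BVar ct_con `&` Vars ct_term = set0
}.

Record rule (Sg : signature) := Rule {
  rl_set : set (var Sg);
  rl_lhs : term Sg;
  rl_rhs : term Sg;
  rl_con : term Sg;
  rl_set_theory : rl_set `<=` @theory_vars Sg;
  rl_sorted : exists a : sort Sg, has_sort rl_lhs a /\ has_sort rl_rhs a;
  rl_con_wf : is_constraint rl_con;
  rl_vars : Vars rl_con `|` (Vars rl_rhs `\` Vars rl_lhs) `<=` rl_set
}.

Definition left_linear (Sg : signature) (rho : rule Sg) : Prop :=
  linear (rl_lhs rho).

Definition ExVar (Sg : signature) (rho : rule Sg) : set (var Sg) :=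
  Vars (rl_rhs rho) `\` Vars (rl_lhs rho).

Definition rule_vars (Sg : signature) (rho : rule Sg) : set (var Sg) :=
  Vars (rl_lhs rho) `|` Vars (rl_rhs rho) `|` Vars (rl_con rho).

Definition vars_diff (Sg : signature) (xs ys : seq (var Sg)) : seq (var Sg) :=
  [seq x <- undup xs | x \notin ys].

Definition is_redex (Sg : signature) (M : model Sg) (S : cterm Sg)
    (rho : rule Sg) (p : seq nat) (gamma : substitution Sg) : Prop :=
  [/\ Dom gamma = Vars (rl_lhs rho),
      subterm_at (ct_term S) p = Some (subst gamma (rl_lhs rho)),
      (forall x, (Vars (rl_lhs rho) `&` rl_set rho) x ->
         (Val `|` (@Var Sg @` ct_set S)) (gamma x))
    & valid_imp M (ct_con S)
        (Ex (vars_diff (vars (rl_con rho)) (vars (rl_lhs rho)))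
            (subst gamma (rl_con rho)))].

Definition mg_step (Sg : signature) (M : model Sg) (rho : rule Sg)
    (p : seq nat) (gamma : substitution Sg) (S T : cterm Sg) : Prop :=
  [/\ satisfiable M (ct_con S),
      left_linear rho,
      rule_vars rho `&` (Vars (ct_term S) `|` Vars (body (ct_con S))) = set0
    & is_redex M S rho p gamma] /\
  [/\ ct_term T = replace_at (ct_term S) p (subst gamma (rl_rhs rho)),
      body (ct_con T) = andt (body (ct_con S)) (subst gamma (rl_con rho)),
      BVar (ct_con T) = Vars (body (ct_con T)) `\` Vars (ct_term T)
    & ct_set T = ExVar rho `|` (ct_set S `&` Vars (ct_term T))].

Definition is_variant (Sg : signature) (rho rho' : rule Sg) : Prop :=
  exists delta : var Sg -> var Sg,
    [/\ bijective delta, forall x, var_sort (delta x) = var_sort x,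
        rl_set rho' = delta @` rl_set rho
      & [/\ rl_lhs rho' = subst (fun x => Var (delta x)) (rl_lhs rho),
            rl_rhs rho' = subst (fun x => Var (delta x)) (rl_rhs rho)
          & rl_con rho' = subst (fun x => Var (delta x)) (rl_con rho)]].

Definition cstep_rule (Sg : signature) (M : model Sg) (rho : rule Sg)
    (S T : cterm Sg) : Prop :=
  exists (rho' : rule Sg) (p : seq nat) (gamma : substitution Sg),
    is_variant rho rho' /\ mg_step M rho' p gamma S T.

Definition cstep (Sg : signature) (M : model Sg) (R : set (rule Sg))
    (S T : cterm Sg) : Prop :=
  exists rho : rule Sg, R rho /\ cstep_rule M rho S T.

Definition csteps (Sg : signature) (M : model Sg) (R : set (rule Sg)) :
    cterm Sg -> cterm Sg -> Prop :=
  clos_refl_trans (cterm Sg) (cstep M R).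

Definition is_equality (Sg : signature) (M : model Sg) (tau : theory_sort Sg)
    (e : theory_sym Sg) : Prop :=
  [/\ theory_dom e = [:: tau; tau], theory_cod e = bool_sort Sg
    & forall a b : value Sg, value_sort a = tau -> value_sort b = tau ->
        interp M e [:: a; b] = vbool M true <-> a = b].

(* Pi {x1,...,xn,y}. f(x1,...,xn) -> y [y = f(x1,...,xn)] *)
Definition is_calculation_rule (Sg : signature) (M : model Sg)
    (f : theory_sym Sg) (rho : rule Sg) : Prop :=
  exists (xs : seq (var Sg)) (y : var Sg) (e : theory_sym Sg),
    let fxs := Fun (ThSym f) [seq Var x | x <- xs] in
    [/\ uniq (y :: xs) : Prop, is_equality M (theory_cod f) e,
        rl_set rho = [set x | x \in y :: xs]
      & [/\ rl_lhs rho = fxs, rl_rhs rho = Var y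
          & rl_con rho = Fun (ThSym e) [:: Var y; fxs]]].

Definition is_LCTRS (Sg : signature) (M : model Sg) (R : set (rule Sg)) :
    Prop :=
  (forall rho, R rho -> left_linear rho) /\
  (forall f : theory_sym Sg, exists rho, R rho /\ is_calculation_rule M f rho).

Definition step (Sg : signature) (P : set (term Sg * term Sg))
    (u v : term Sg) : Prop :=
  exists (p : seq nat) (l r : term Sg) (theta : substitution Sg),
    [/\ P (l, r), subterm_at u p = Some (subst theta l)
      & v = replace_at u p (subst theta r)].

Definition steps (Sg : signature) (P : set (term Sg * term Sg)) :
    term Sg -> term Sg -> Prop :=
  clos_refl_trans (term Sg) (step P).

Definition cterm_interp (Sg : signature) (M : model Sg) (S : cterm Sg) :
    set (term Sg) :=
  [set u | exists s : substitution Sg,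
     [/\ u = subst s (ct_term S), valued (ct_set S) s & models M s (ct_con S)]].

Definition rule_interp (Sg : signature) (M : model Sg) (rho : rule Sg) :
    set (term Sg * term Sg) :=
  [set lr | exists s : substitution Sg,
     [/\ lr = (subst s (rl_lhs rho), subst s (rl_rhs rho)),
         Dom s = VDom s,
         VDom s = rl_set rho `&` (Vars (rl_lhs rho) `|` Vars (rl_rhs rho))
       & models M s
           (Ex (vars_diff (vars (rl_con rho))
                  (vars (rl_lhs rho) ++ vars (rl_rhs rho)))
               (rl_con rho))]].

Definition rules_interp (Sg : signature) (M : model Sg) (R : set (rule Sg)) :
    set (term Sg * term Sg) :=
  \bigcup_(rho in R) rule_interp M rho.

(* Main.v *)
Require Import Defs.
From mathcomp Require Import all_boot.
From mathcomp Require Import boolp classical_sets.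
From mathcomp Require Import cardinality.
From Stdlib Require List.
From Stdlib Require Import Relation_Operators.

(** By [modelsP], [sigma] satisfies an existential constraint iff some valuation
    agrees with [sigma] on the free variables and makes the body true.  A most
    general step from [s] to [t] is therefore reflected by every pair
    [(s sigma, t sigma)] for which [sigma] is value-valued on [X] and on the extra
    variables of the rule, and some valuation compatible with [sigma] makes
    [pi gamma] true ([mg_step_instance]).  It remains to extend a substitution
    along the step.  Forwards, the redex condition yields values for the extra
    variables of the rule, compatible with a witness of [phi] since the rule is
    variable disjoint from [s] and [phi].  Backwards, the witness of
    [phi /\ pi gamma] gives values for the variables of [X] that do not occur in
    [t]. *)

Local Open Scope classical_set_scope.

Local Notation vterm a := (Fun (ValSym a) [::]).

(** * Terms, substitutions and positions *)

Lemma term_nested_ind [Sg : signature] (P : term Sg -> Prop) :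
  (forall x, P (Var x)) ->
  (forall f ts, List.Forall P ts -> P (Fun f ts)) ->
  forall t, P t.
Proof.
move=> hV hF; fix IH 1 => -[x|f ts]; first exact: hV.
by apply: hF; elim: ts => [|t ts IHts]; constructor.
Qed.

Lemma eq_in_map_Forall {A B : Type} (f g : A -> B) (s : seq A) :
  List.Forall (fun x => f x = g x) s -> map f s = map g s.
Proof. by elim=> //= x l -> _ ->. Qed.

Lemma mem_vars_subst {Sg : signature} (s : var Sg -> term Sg) (t : term Sg) x :
  reflect (exists2 y, y \in vars t & x \in vars (s y)) (x \in vars (subst s t)).
Proof.
apply: (iffP idP).
- elim/term_nested_ind: t => [y hx|f ts /= IH]; first by exists y; rewrite ?inE.
  elim: IH => //= t l IHt _ IHl; rewrite mem_cat => /orP[/IHt|/IHl] [y hy hx];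
    by exists y => //; rewrite mem_cat hy ?orbT.
- case=> y; elim/term_nested_ind: t => [z|f ts /= IH]; first by rewrite inE => /eqP->.
  elim: IH => //= t l IHt _ IHl; rewrite !mem_cat => /orP[hy|hy] hx.
  + by rewrite IHt.
  + by rewrite IHl // orbT.
Qed.

Lemma eq_in_subst {Sg : signature} (s1 s2 : var Sg -> term Sg) (t : term Sg) :
  {in vars t, s1 =1 s2} -> subst s1 t = subst s2 t.
Proof.
elim/term_nested_ind: t => [x|f ts IH] /= h; first by apply: h; rewrite inE.
congr Fun; elim: IH h => //= t l IHt _ IHl h.
by rewrite IHt ?IHl // => x hx; apply: h; rewrite mem_cat hx ?orbT.
Qed.

Lemma subst_subst {Sg : signature} (s1 s2 : var Sg -> term Sg) (t : term Sg) :
  subst s2 (subst s1 t) = subst (fun x => subst s2 (s1 x)) t.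
Proof.
elim/term_nested_ind: t => [x|f ts IH] //=.
by rewrite -map_comp; congr Fun; apply: eq_in_map_Forall.
Qed.

Lemma has_sort_subst {Sg : signature} (s : var Sg -> term Sg) (t : term Sg) a :
  (forall x, has_sort (s x) (var_sort x)) -> has_sort t a ->
  has_sort (subst s t) a.
Proof.
move=> hs; elim/term_nested_ind: t a => [x|f ts IH] a ht.
- by inversion ht; subst; exact: hs.
- inversion ht as [|f' ts' hts]; subst; constructor.
  elim: hts IH => //= t b l l' htb _ IHl IH; inversion IH; subst.
  by constructor; auto.
Qed.

Lemma subterm_at_subst {Sg : signature} (s : var Sg -> term Sg) t p w :
  subterm_at t p = Some w -> subterm_at (subst s t) p = Some (subst s w).
Proof.
elim: p t => [|i p IH] [x|f ts] //= => [[<-]|[<-]|] //.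
by rewrite onth_map; case: (onth ts i) => //= u /IH.
Qed.

Lemma replace_at_subst {Sg : signature} (s : var Sg -> term Sg) t p w u :
  subterm_at t p = Some w ->
  subst s (replace_at t p u) = replace_at (subst s t) p (subst s u).
Proof.
elim: p t => [|i p IH] [x|f ts] //=.
rewrite onth_map; case: (onth ts i) => //= v /IH <-.
by rewrite map_cat /= map_take map_drop.
Qed.

(** * Evaluation of constraints *)

Lemma eval_subst {Sg : signature} (M : model Sg) (nu : var Sg -> value Sg) s t :
  eval M nu (subst s t) = eval M (fun x => eval M nu (s x)) t.
Proof.
elim/term_nested_ind: t => [x|[a|f|f] ts IH] //=.
by rewrite -map_comp; congr interp; apply: eq_in_map_Forall.
Qed.

Lemma eq_in_eval {Sg : signature} (M : model Sg) (nu mu : var Sg -> value Sg) t :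
  {in vars t, nu =1 mu} -> eval M nu t = eval M mu t.
Proof.
elim/term_nested_ind: t => [x|[a|f|f] ts IH] //= h.
- by apply: h; rewrite inE.
- congr interp; elim: IH h => //= t l IHt _ IHl h.
  by rewrite IHt ?IHl // => x hx; apply: h; rewrite mem_cat hx ?orbT.
Qed.

Lemma value_sort_eval {Sg : signature} (M : model Sg) (nu : valuation Sg) t tau :
  theory_term t -> has_sort t (inl tau) -> value_sort (eval M nu t) = tau.
Proof.
elim/term_nested_ind: t tau => [x|[a|f|f] ts IH] tau //= hth ht.
- by inversion ht as [x' hx|]; apply: val_sorted.
- by inversion ht.
- inversion ht as [|f' ts' hts]; subst; apply: interp_sort.
  move: hts => /=; elim: (theory_dom f) ts IH hth {ht} => [|b l IHl] ts IH hth hts.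
    by inversion hts.
  inversion hts; subst; inversion IH; subst.
  by move: hth => /= /andP[h1 h2]; rewrite /= IHl //; congr cons; auto.
Qed.

Lemma eval_constraint {Sg : signature} (M : model Sg) (nu : valuation Sg) phi :
  is_constraint phi -> exists b, eval M nu phi = vbool M b.
Proof. by case=> hs ht; apply/(vbool_onto M)/value_sort_eval. Qed.

Lemma is_constraint_andt {Sg : signature} (phi psi : term Sg) :
  is_constraint (andt phi psi) -> is_constraint phi /\ is_constraint psi.
Proof.
case=> hs /= /and3P[t1 t2 _]; inversion hs as [|f ts hts]; subst.
move: hts; rewrite /= and_dom /= => h.
inversion h as [|? ? ? ? h1 h']; subst.
by inversion h' as [|? ? ? ? h2 _]; subst.
Qed.

(** The model fixes [and_sym] on Booleans only, so both conjuncts must first be seen to evaluate to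
    some [vbool]; their sorts guarantee this. *)
Lemma eval_andt {Sg : signature} (M : model Sg) (nu : valuation Sg) phi psi :
  is_constraint (andt phi psi) ->
  eval M nu (andt phi psi) = vbool M true <->
  eval M nu phi = vbool M true /\ eval M nu psi = vbool M true.
Proof.
case/is_constraint_andt => /(eval_constraint M nu)[a /= ->].
move=> /(eval_constraint M nu)[b ->]; rewrite interp_and.
split; last by case=> /vbool_inj-> /vbool_inj->.
by move=> /vbool_inj/andP[-> ->].
Qed.

(** * Values, valuations and satisfaction of existential constraints *)

Lemma has_sort_vterm {Sg : signature} (a : value Sg) tau :
  value_sort a = tau -> has_sort (vterm a) (inl tau).
Proof. by move=> <-; apply: (has_sort_fun (f := ValSym a)). Qed.

Lemma value_sort_vterm {Sg : signature} (a : value Sg) tau :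
  has_sort (vterm a) (inl tau) -> value_sort a = tau.
Proof. by move=> h; inversion h. Qed.

Lemma valuation_inhabited {Sg : signature} (M : model Sg) : valuation Sg.
Proof.
pose f (x : var Sg) : value Sg :=
  match var_sort x with
  | inl tau => projT1 (cid (carrier_nonempty M tau))
  | inr _ => vbool M true
  end.
by exists f => x tau h; rewrite /f h; case: cid.
Qed.

Definition mix {Sg : signature} (b : pred (var Sg)) (nu mu : valuation Sg) :
  valuation Sg.
Proof.
exists (fun x => if b x then nu x else mu x).
by move=> x tau h; case: (b x); apply: val_sorted.
Defined.

(** The overridden variables are given as a list so that the domain stays finite. *)
Definition patch {Sg : signature} (s : substitution Sg) (D : seq (var Sg))
  (f : var Sg -> term Sg)
  (hf : forall x, x \in D -> has_sort (f x) (var_sort x)) : substitution Sg.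
Proof.
exists (fun x => if x \in D then f x else s x).
- by move=> x; case: ifP => [/hf|_] //; apply: subst_sorted.
- apply: (@sub_finite_set _ _ ([set` D] `|` Dom s)).
    by move=> x; rewrite /Dom /=; case: ifP => ?; [left|right].
  by rewrite finite_setU; split; [exact: finite_seq|exact: subst_finite].
Defined.

Definition id_subst (Sg : signature) : substitution Sg.
Proof.
exists (@Var Sg); first by move=> x; constructor.
by apply: (@sub_finite_set _ _ set0) => // x; rewrite /Dom.
Defined.

(** Once values replace the free variables, the ambient valuation no longer matters: validity at a
    single valuation already yields [nu], and conversely the values of [nu] on the bound variables
    serve as witness at every valuation. *)
Lemma modelsP {Sg : signature} (M : model Sg) (s : substitution Sg)
    (e : exformula Sg) :
  models M s e <->
  exists nu : valuation Sg,
    (forall x, FVar e x -> s x = vterm (nu x)) /\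
    eval M nu (body e) = vbool M true.
Proof.
split.
- case=> hv hval; have [nu [_ /=]] := hval (valuation_inhabited M).
  rewrite eval_subst => h.
  (* [g] reads off the values that [s] assigns outside the bound variables; everywhere else the
     witness [nu] is kept, which is well sorted. *)
  pose g x := if s x is Fun (ValSym a) [::] then
    if x \in bvars e then nu x else a else nu x.
  have gs x tau : var_sort x = inl tau -> value_sort (g x) = tau.
    move=> hx; have := subst_sorted s x; rewrite hx /g.
    case: (subst_fun s x) => [?|[a|?|?] [|? ?]] h'; try exact: val_sorted.
    by case: ifP => _; [exact: val_sorted|exact: value_sort_vterm].
  have gF x : FVar e x -> s x = vterm (g x).
    move=> hx; have [a ha] : Val (s x) by apply: hv; exists x.
    by case: hx => _ /negP/negbTE hb; rewrite /g ha hb.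
  exists (Valuation gs); split; first exact: gF.
  rewrite -h; apply: eq_in_eval => x hx /=.
  case: ifP => hb; first by rewrite /g hb /=; case: (s x) => [?|[?|?|?] [|? ?]].
  by rewrite gF //; split=> //; rewrite /BVar /= hb.
- case=> nu [hs h]; split.
    by move=> _ [x hx <-]; exists (nu x); apply: hs.
  move=> mu; exists (mix (fun x => x \in bvars e) nu mu); split.
    by move=> x /= /negbTE->.
  rewrite /= eval_subst -h; apply: eq_in_eval => x hx.
  case: ifP => hb /=; first by rewrite hb.
  by rewrite hs //; split=> //; rewrite /BVar /= hb.
Qed.

(** * Rewriting with instances of a rule *)

Lemma in_vars_diff {Sg : signature} (xs ys : seq (var Sg)) x :
  (x \in vars_diff xs ys) = (x \in xs) && (x \notin ys).
Proof. by rewrite mem_filter mem_undup andbC. Qed.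

(* The substitution [f] instantiates the rule directly; it is split into the
   value part on [rl_set rho] required by [rule_interp] and the matching
   substitution of the rewrite step. *)
Lemma step_rule_interp {Sg : signature} (M : model Sg) (rho : rule Sg)
    (f : var Sg -> term Sg) (kappa : valuation Sg) u p :
  (forall x, has_sort (f x) (var_sort x)) ->
  (forall x, rl_set rho x -> x \in vars (rl_lhs rho) ++ vars (rl_rhs rho) ->
     Val (f x)) ->
  (forall x, x \in vars (rl_con rho) ->
     x \in vars (rl_lhs rho) ++ vars (rl_rhs rho) -> f x = vterm (kappa x)) ->
  eval M kappa (rl_con rho) = vbool M true ->
  subterm_at u p = Some (subst f (rl_lhs rho)) ->
  step (rule_interp M rho) u (replace_at u p (subst f (rl_rhs rho))).
Proof.
move=> fs fval fkappa hk hu.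
set V := vars (rl_lhs rho) ++ vars (rl_rhs rho) in fval fkappa.
pose D := [seq x <- V | `[< rl_set rho x >]].
pose tau := patch (id_subst Sg) D f (fun x _ => fs x).
pose theta := patch (id_subst Sg) V f (fun x _ => fs x).
have inD x : x \in D = `[< rl_set rho x >] && (x \in V) by rewrite mem_filter.
(* [theta] may coincide with [f] on all of [V]: where [tau] acts it produces values, which are
   closed and hence fixed by [theta]. *)
have tauK t : {subset vars t <= V} -> subst theta (subst tau t) = subst f t.
  move=> ht; rewrite subst_subst; apply: eq_in_subst => x /ht hx /=.
  rewrite inD hx andbT; case: asboolP => [hZ|_] /=; last by rewrite hx.
  by have [a ->] := fval x hZ hx.
have DE : Dom tau = VDom tau.
  apply/seteqP; split=> x; rewrite /Dom /VDom /=; case: ifP => //.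
  - by rewrite inD => /andP[/asboolP hZ hx] _; apply: fval.
  - by rewrite inD => /andP[/asboolP hZ hx] _; case: (fval x hZ hx) => a ->.
  - by move=> _ [].
exists p, (subst tau (rl_lhs rho)), (subst tau (rl_rhs rho)), theta.
rewrite !tauK; first last.
- by move=> x; rewrite mem_cat => ->.
- by move=> x; rewrite mem_cat => ->; rewrite orbT.
split=> //; exists tau; split=> //.
- apply/seteqP; split=> x; rewrite /VDom /=.
  + case: ifP => [|_ [] //]; rewrite inD => /andP[/asboolP hZ hx] _.
    by split=> //; apply/orP; rewrite -mem_cat.
  + by case=> hZ /orP; rewrite -mem_cat => hx; rewrite inD hx asboolT //; apply: fval.
- apply/modelsP; exists kappa; split=> //= x [hx /=].
  rewrite /BVar /= in_vars_diff hx /= => /negP; rewrite negbK => hV.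
  rewrite inD hV asboolT; first by rewrite fkappa.
  by apply: rl_vars; left.
Qed.

Lemma vars_rename {Sg : signature} (delta : var Sg -> var Sg) (t : term Sg) x :
  x \in vars t -> delta x \in vars (subst (fun x => Var (delta x)) t).
Proof. by move=> hx; apply/mem_vars_subst; exists x; rewrite //= inE. Qed.

(** Composing the renaming, [gamma] and [sigma] instantiates the original rule [rho] directly, so
    interpretations of variants need not be compared. Both simulation directions use this. *)
Lemma mg_step_instance {Sg : signature} (M : model Sg) (rho rho' : rule Sg) p
    (gamma : substitution Sg) (S T : cterm Sg) (sigma : substitution Sg)
    (nu : valuation Sg) :
  is_variant rho rho' -> mg_step M rho' p gamma S T ->
  valued (ct_set S `|` ExVar rho') sigma ->
  (forall x, (ct_set S `|` ExVar rho') x ->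
     x \in vars (subst gamma (rl_con rho')) -> sigma x = vterm (nu x)) ->
  eval M nu (subst gamma (rl_con rho')) = vbool M true ->
  step (rule_interp M rho) (subst sigma (ct_term S)) (subst sigma (ct_term T)).
Proof.
case=> delta [dbij dsort setE [lE rE cE]].
case=> [[_ _ _ [domE subE hval _]] [tE _ _ _]] sval snu hnu.
have gid x : x \notin vars (rl_lhs rho') -> gamma x = Var x.
  move=> hx; apply: contrapT => h; have : Dom gamma x by [].
  by rewrite domE /Vars /= (negbTE hx).
have gcon x : x \in vars (rl_con rho') -> theory_term (gamma x).
  move=> hx; case hl: (x \in vars (rl_lhs rho')); last by rewrite gid ?hl.
  have /hval : (Vars (rl_lhs rho') `&` rl_set rho') x.
    by split=> //; apply: rl_vars; left.
  by case=> [[a ->]|[y _ <-]].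
have fval x : rl_set rho' x -> x \in vars (rl_lhs rho') ++ vars (rl_rhs rho') ->
    Val (gamma x) \/ exists2 y, (ct_set S `|` ExVar rho') y & gamma x = Var y.
  move=> hZ; rewrite mem_cat => hx; case hl: (x \in vars (rl_lhs rho')).
    by have /hval[|[y hy <-]] := conj hl hZ; [left|right; exists y => //; left].
  right; exists x; last by rewrite gid ?hl.
  by right; split; [move: hx; rewrite hl|rewrite /Vars /= hl].
(* On variables of the constraint, [gamma] yields values or variables, so evaluation respects sorts.
   Elsewhere the image may contain term symbols, and [nu (delta x)] is a well-sorted default. *)
pose k x :=
  if x \in vars (rl_con rho) then eval M nu (gamma (delta x)) else nu (delta x).
have ks x tau : var_sort x = inl tau -> value_sort (k x) = tau.
  rewrite -dsort /k => hx; case: ifP => [hc|_]; last exact: val_sorted.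
  apply: value_sort_eval; last by rewrite -hx; apply: subst_sorted.
  by apply: gcon; rewrite cE; apply: vars_rename.
have renV x : x \in vars (rl_lhs rho) ++ vars (rl_rhs rho) ->
    delta x \in vars (rl_lhs rho') ++ vars (rl_rhs rho').
  by rewrite !mem_cat lE rE => /orP[] /(vars_rename delta)->; rewrite ?orbT.
have renZ x : rl_set rho x -> rl_set rho' (delta x) by rewrite setE => hx; exists x.
pose f x := subst sigma (gamma (delta x)).
have fE t : subst f t = subst sigma (subst gamma (subst (fun x => Var (delta x)) t)).
  by rewrite !subst_subst.
rewrite tE (replace_at_subst _ _ _ _ _ subE) rE -fE.
apply: (step_rule_interp M rho f (Valuation ks)).
- by move=> x; rewrite /f -dsort; apply: has_sort_subst; apply: subst_sorted.
- move=> x /renZ hZ /renV hx; rewrite /f.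
  case: (fval _ hZ hx) => [[a ->]|[y hy ->]]; first by exists a.
  by apply: sval; exists y.
- move=> x hc hV; rewrite /f /= /k hc.
  have hc' : delta x \in vars (rl_con rho') by rewrite cE; apply: vars_rename.
  have hZ : rl_set rho' (delta x) by apply: rl_vars; left.
  case: (fval _ hZ (renV _ hV)) => [[a ->] //|[y hy hg]]; rewrite hg /= snu //.
  by apply/mem_vars_subst; exists (delta x); rewrite // hg inE.
- rewrite -hnu cE !eval_subst; apply: eq_in_eval => x hx /=.
  by rewrite /k hx.
- by rewrite fE -lE; apply: subterm_at_subst.
Qed.

(** * Forward simulation of one step *)

Lemma cstep_forward {Sg : signature} (M : model Sg) (R : set (rule Sg))
    (S T : cterm Sg) u :
  cstep M R S T -> cterm_interp M S u ->
  exists v, cterm_interp M T v /\ step (rules_interp M R) u v.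
Proof.
case=> rho [Rrho [rho' [p [gamma [hvar hstep]]]]].
move=> [sigma [-> sval /modelsP[nu0 [nu0s hphi]]]].
have [[_ _ hdisj [domE subE hval himp]] [tE bodyE bvE setE]] := hstep.
have disj x : rule_vars rho' x -> x \notin vars (ct_term S) /\ x \notin vars (body (ct_con S)).
  by move=> hx; split; apply/negP=> h;
    suff : set0 x by []; rewrite -hdisj; split=> //; [left|right].
have conR x : x \in vars (rl_con rho') -> rule_vars rho' x by right.
have bvS x : x \in bvars (ct_con S) ->
    x \in vars (body (ct_con S)) /\ x \notin vars (ct_term S).
  move=> hx; split; first by have [_] := ct_con_wf S; apply.
  by apply/negP=> h; suff : set0 x by []; rewrite -(ct_bvar S).
(* [nu0] follows [sigma] only on the free variables of the source constraint, but the instantiated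
   rule constraint may contain any variable of [ct_set S]; [nus] follows [sigma] on all of them. *)
have [nus [nusX nusE]] : exists nu : valuation Sg,
    (forall x, ct_set S x -> sigma x = vterm (nu x)) /\
    (forall x, x \in vars (body (ct_con S)) -> x \notin bvars (ct_con S) ->
       nu x = nu0 x).
  pose g x := if sigma x is Fun (ValSym a) [::] then a else nu0 x.
  have gs x tau : var_sort x = inl tau -> value_sort (g x) = tau.
    move=> hx; have := subst_sorted sigma x; rewrite hx /g.
    case: (subst_fun sigma x) => [?|[a|?|?] [|? ?]] h'; try exact: val_sorted.
    exact: value_sort_vterm.
  exists (Valuation gs); split=> [x hx|x hx hb] /=.
    have [a ha] : Val (sigma x) by apply: sval; exists x.
    by rewrite /g ha.
  by rewrite /g nu0s //; split=> //; apply/negP.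
have /himp [nu1 /= [nu1E hpi]] : holds M nus (ct_con S).
  exists (mix (fun x => x \in bvars (ct_con S)) nu0 nus); split.
    by move=> x /= /negbTE->.
  rewrite -hphi; apply: eq_in_eval => x hx /=.
  case: ifP => // /negbT.
  exact: nusE.
(* One valuation for both conjuncts: [nu0] witnesses the bound variables of the source constraint,
   [nu1] the extra variables of the rule constraint. *)
pose nu := mix (fun x => x \in bvars (ct_con S)) nu0 nu1.
have nuE x : nu x = if x \in bvars (ct_con S) then nu0 x else nu1 x by [].
have nu1S x : x \in vars (ct_term S) \/ x \in vars (body (ct_con S)) ->
    nu1 x = nus x.
  move=> hx; apply: nu1E; rewrite in_vars_diff; apply/negP=> /andP[/conR/disj[h1 h2] _].
  by case: hx => h; [rewrite h in h1|rewrite h in h2].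
have nuX x : ct_set S x -> sigma x = vterm (nu x).
  move=> hx; have hs := ct_set_vars hx; rewrite nuE.
  case: ifP => [/bvS[_]|_]; first by rewrite (hs : x \in _).
  by rewrite nu1S; [exact: nusX|left].
have hphi' : eval M nu (body (ct_con S)) = vbool M true.
  rewrite -hphi; apply: eq_in_eval => x hx; rewrite nuE; case: ifP => // /negbT hb.
  by rewrite nu1S ?nusE //; right.
(* A variable of the instantiated rule constraint lies in [ct_set S] or belongs to the rule; neither
   kind is bound in the source constraint, so [nu] and [nu1] agree there. *)
have hpi' : eval M nu (subst gamma (rl_con rho')) = vbool M true.
  rewrite -hpi; apply: eq_in_eval => x /mem_vars_subst[y hy hxy].
  rewrite nuE; case: ifP => // /bvS[h1 h2].
  case: (pselect (Dom gamma y)) => [|hd].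
    rewrite domE => hl; have /hval : (Vars (rl_lhs rho') `&` rl_set rho') y.
      by split=> //; apply: rl_vars; left.
    case=> [[a ha]|[z hz ha]]; first by rewrite ha in hxy.
    move: hxy; rewrite -ha inE => /eqP xz; subst z.
    by move: h2; rewrite (ct_set_vars hz : x \in _).
  move: hxy; rewrite (contrapT hd) inE => /eqP xy; subst y.
  by have [_] := disj x (conR x hy); rewrite h1.
have Exsort x : x \in vars_diff (vars (rl_rhs rho')) (vars (rl_lhs rho')) ->
    has_sort (vterm (nu x)) (var_sort x).
  rewrite in_vars_diff => /andP[hr hl].
  have [tau htau] : theory_vars x.
    by apply: (@rl_set_theory _ rho'); apply: rl_vars; right; split=> //; apply/negP.
  by rewrite htau; apply: has_sort_vterm; apply: val_sorted.
(* The extra variables of the rule do not occur in the source term, so this change leaves the source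
   instance intact. *)
pose sigma' := patch sigma _ (fun x => vterm (nu x)) Exsort.
have s'Ex x : ExVar rho' x -> sigma' x = vterm (nu x).
  by case=> hr hl; rewrite /sigma' /= in_vars_diff (hr : x \in _) (introN idP hl).
have s'S x : x \in vars (ct_term S) -> sigma' x = sigma x.
  move=> hx; rewrite /sigma' /= in_vars_diff; case: ifP => // /andP[hr _].
  have [] : x \notin vars (ct_term S) /\ x \notin vars (body (ct_con S)).
    by apply: disj; left; right.
  by rewrite hx.
have s'nu x : (ct_set S `|` ExVar rho') x -> sigma' x = vterm (nu x).
  by case=> [hx|/s'Ex //]; rewrite s'S ?nuX //; exact: ct_set_vars hx.
exists (subst sigma' (ct_term T)); split.
- have YE x : ct_set T x -> sigma' x = vterm (nu x).
    by rewrite setE => -[hx|[hx _]]; apply: s'nu; [right|left].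
  exists sigma'; split=> //.
    by move=> _ [x hx <-]; exists (nu x); apply: YE.
  apply/modelsP; exists nu; split=> [x /ct_fvar/YE //|].
  have [hc _] := ct_con_wf T; rewrite bodyE in hc *.
  by apply/eval_andt.
- rewrite (eq_in_subst sigma sigma'); last by move=> x /s'S.
  have [p' [l [r [theta [h1 h2 h3]]]]] : step (rule_interp M rho)
      (subst sigma' (ct_term S)) (subst sigma' (ct_term T)).
    apply: (mg_step_instance M rho rho' p gamma S T sigma' nu hvar hstep) => //.
    + by move=> _ [x hx <-]; exists (nu x); apply: s'nu.
    + by move=> x hx _; apply: s'nu.
  by exists p', l, r, theta; split=> //; exists rho.
Qed.

(** * Backward simulation of one step *)

Lemma cstep_backward {Sg : signature} (M : model Sg) (R : set (rule Sg))
    (S T : cterm Sg) v :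
  cstep M R S T -> cterm_interp M T v ->
  exists u, cterm_interp M S u /\ step (rules_interp M R) u v.
Proof.
case=> rho [Rrho [rho' [p [gamma [hvar hstep]]]]].
move=> [sigma' [-> sval /modelsP[nu [nus]]]].
have [_ [tE bodyE bvE setE]] := hstep.
have [hc _] := ct_con_wf T; rewrite bodyE in hc *.
case/(eval_andt M nu _ _ hc) => hphi hpi.
(* The bound variables of the target are exactly those missing from its term, so a constraint
   variable occurring in the term is free. *)
have nuT x : x \in vars (body (ct_con T)) -> x \in vars (ct_term T) ->
    sigma' x = vterm (nu x).
  by move=> hx ht; apply: nus; split=> //; rewrite bvE => -[].
(* The variables of [ct_set S] erased by the step: [sigma'] need not map them to values, and
   changing it there does not affect the target instance. *)
pose D := [seq x <- vars (ct_term S) | `[< ct_set S x >] && (x \notin vars (ct_term T))].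
have Dsort x : x \in D -> has_sort (vterm (nu x)) (var_sort x).
  rewrite mem_filter => /andP[/andP[/asboolP /ct_set_theory[tau htau] _] _].
  by rewrite htau; apply: has_sort_vterm; apply: val_sorted.
pose sigma := patch sigma' D (fun x => vterm (nu x)) Dsort.
have sT x : x \in vars (ct_term T) -> sigma x = sigma' x.
  by move=> hx; rewrite /sigma /= mem_filter hx andbF.
have sX x : ct_set S x -> x \notin vars (ct_term T) -> sigma x = vterm (nu x).
  move=> hx ht; rewrite /sigma /= mem_filter asboolT //= ht.
  by rewrite (ct_set_vars hx : x \in _).
(* Variables surviving in the target term lie in [ct_set T], where [sigma'] is valued; erased ones
   of [ct_set S] take values from [nu]. Extra variables are never erased, since [ct_set T] contains
   them. *)
have hval x : (ct_set S `|` ExVar rho') x -> Val (sigma x).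
  case: (boolP (x \in vars (ct_term T))) => ht hx.
    rewrite sT //; apply: sval; exists x => //; rewrite setE.
    by case: hx => hx; [right|left].
  case: hx => hx; first by exists (nu x); apply: sX.
  have /(@ct_set_vars _ T) : ct_set T x by rewrite setE; left.
  by move=> h; rewrite (h : x \in _) in ht.
have hnu x : (ct_set S `|` ExVar rho') x -> x \in vars (body (ct_con T)) ->
    sigma x = vterm (nu x).
  move=> hx hb; case: (boolP (x \in vars (ct_term T))) => ht.
    by rewrite sT // nuT.
  case: hx => hx; first exact: sX.
  have /(@ct_set_vars _ T) : ct_set T x by rewrite setE; left.
  by move=> h; rewrite (h : x \in _) in ht.
exists (subst sigma (ct_term S)); split.
- exists sigma; split=> //; first by move=> _ [x hx <-]; apply: hval; left.
  apply/modelsP; exists nu; split=> // x hx.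
  apply: hnu; first by left; apply: ct_fvar.
  by rewrite bodyE /= mem_cat; case: hx => h _; rewrite (h : x \in _).
- rewrite (eq_in_subst sigma' sigma); last by move=> x /sT.
  have [p' [l [r [theta [h1 h2 h3]]]]] : step (rule_interp M rho)
      (subst sigma (ct_term S)) (subst sigma (ct_term T)).
    apply: (mg_step_instance M rho rho' p gamma S T sigma nu hvar hstep) => //.
    + by move=> _ [x hx <-]; apply: hval.
    + by move=> x hx hc'; apply: hnu; rewrite // bodyE /= !mem_cat hc' orbT.
  by exists p', l, r, theta; split=> //; exists rho.
Qed.

(** * Sequences of steps *)

Theorem theorem4p10 (Sg : signature) (M : model Sg) (R : set (rule Sg))
    (hR : is_LCTRS M R) (S T : cterm Sg) (hST : csteps M R S T) :
  (forall u : term Sg, cterm_interp M S u ->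
     exists v : term Sg, cterm_interp M T v /\ steps (rules_interp M R) u v) /\
  (forall v : term Sg, cterm_interp M T v ->
     exists u : term Sg, cterm_interp M S u /\ steps (rules_interp M R) u v).
Proof.
(* For a composed sequence, the forward claims are chained from the source on and the backward
   claims from the target back. *)
elim: hST => [S1 T1 h|S1|S1 S2 S3 _ [f12 b12] _ [f23 b23]]; split=> u hu.
- have [v [hv st]] := cstep_forward M R S1 T1 u h hu.
  by exists v; split=> //; apply: rt_step.
- have [v [hv st]] := cstep_backward M R S1 T1 u h hu.
  by exists v; split=> //; apply: rt_step.
- by exists u; split=> //; apply: rt_refl.
- by exists u; split=> //; apply: rt_refl.
- have [v [/f23[w [hw s2]] s1]] := f12 u hu.
  by exists w; split=> //; apply: rt_trans s1 s2.
- have [v [/b12[w [hw s2]] s1]] := b23 u hu.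
  by exists w; split=> //; apply: rt_trans s2 s1.
Qed.
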